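(* For a sequence of points in a metric space $(X,d)$ arriving in pairs in an online fashion, one can maintain (deterministically, against an adaptive adversary) a perfect matching on $S_i$ of weight $O(\log|S_i|)\cdot\mathrm{Cost}(\mathrm{MST}(S_i))$ using recourse $O(\log^2|S_i|)$, where $S_i$ is the set of the first $2i$ points.
   Context: Points $s_1,s_2,\dots$ of a metric space arrive one pair at a time, with distances to earlier points revealed on arrival; after the $i$-th pair the algorithm maintains a perfect matching on $S_i=\{s_1,\dots,s_{2i}\}$. Recourse is the number of edges of the current matching deleted when processing a new pair. $\mathrm{Cost}(\mathrm{MST}(S_i))$ is the total weight of a minimum spanning tree of $S_i$ in the complete graph weighted by $d$; the weight of a matching is the sum of distances of its pairs. An adaptive adversary may choose each new point depending on the algorithm's previous decisions. *)

(* Defs.v *)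
From HB Require Import structures.
From mathcomp Require Import all_boot all_order all_algebra.
From mathcomp Require Import finmap.
From mathcomp Require Import all_classical all_reals all_analysis.

Set Implicit Arguments.
Unset Strict Implicit.
Unset Printing Implicit Defensive.
Import Order.TTheory GRing.Theory Num.Theory.
Local Open Scope ring_scope.

(* A point of the input is identified with its arrival index (from 0), so that
   co-located points remain distinct requests and [S_i] always has [2 i]
   elements.  An undirected edge [{a, b}] is encoded as the pair [(a, b)] with
   [a < b]; [edges_on] enforces this orientation. *)
Definition edge_set := {fset nat * nat}.

Definition edges_on (n : nat) (E : edge_set) : Prop :=
  forall e, e \in E -> (e.1 < e.2 < n)%N.

Definition incident (v : nat) (e : nat * nat) : bool := (v == e.1) || (v == e.2).

Definition perfect_matching (n : nat) (M : edge_set) : Prop :=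
  edges_on n M /\
  forall v, (v < n)%N -> exists! e, (e \in M) && incident v e.

Definition adjacent (n : nat) (E : edge_set) : rel 'I_n :=
  fun x y => ((val x, val y) \in E) || ((val y, val x) \in E).

Definition spanning_tree (n : nat) (T : edge_set) : Prop :=
  [/\ edges_on n T,
      forall x y : 'I_n, connect (adjacent T) x y
    & forall c : seq 'I_n, (2 < size c)%N -> ~ ucycle (adjacent T) c].

Definition weight (R : realType) (X : metricType R) (s : nat -> X)
    (E : edge_set) : R :=
  \sum_(e <- E) mdist (s e.1) (s e.2).

Definition minimum_spanning_tree (R : realType) (X : metricType R)
    (s : nat -> X) (n : nat) (T : edge_set) : Prop :=
  spanning_tree n T /\
  forall T', spanning_tree n T' -> weight s T <= weight s T'.

(* After the [k]-th pair the algorithm has seen exactly the distances between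
   the first [2 k] points.  Being deterministic, its own earlier decisions are
   functions of submatrices of this matrix, so they need not be arguments. *)
Definition online_algorithm (R : realType) : Type :=
  forall k : nat, 'M[R]_(k.*2) -> edge_set.

Definition revealed (R : realType) (X : metricType R) (s : nat -> X)
    (k : nat) : 'M[R]_(k.*2) :=
  \matrix_(a, b) mdist (s a) (s b).

(* No point, hence the empty matching, before the first pair. *)
Definition current_matching (R : realType) (X : metricType R)
    (A : online_algorithm R) (s : nat -> X) (k : nat) : edge_set :=
  if k is 0 then fset0 else A k (revealed s k).

(* The adversary maps the matchings output so far, oldest first, to the next
   pair of points. *)
Definition adversary (R : realType) (X : metricType R) : Type :=
  seq edge_set -> X * X.

Definition generated_by (R : realType) (X : metricType R)
    (A : online_algorithm R) (adv : adversary X) (s : nat -> X) : Prop :=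
  forall k : nat,
    (s k.*2, s k.*2.+1)
    = adv [seq current_matching A s i | i <- iota 1 k].

Definition recourse (M M' : edge_set) : nat := #|` (M `\` M')%fset|.

Lemma star_spanning_tree (n : nat) :
  spanning_tree n [fset (0%N, j) | j in iota 1 n.-1]%fset.
Proof.
set T := [fset _ | _ in _]%fset.
have inT a b : ((a, b) \in T) = (a == 0)%N && (0 < b < n)%N.
  apply/imfsetP/idP => /= [[j]|/andP[/eqP-> jn]].
    by rewrite mem_iota add1n => jn [-> ->]; case: n jn {T} => [|n] /=; case: j.
  by exists b => //; rewrite mem_iota add1n; case: n jn {T} => [|n] //=; case: b.
split.
- by move=> [a b]; rewrite inT /= => /andP[/eqP->].
- have to0 (x y : 'I_n) : val x = 0%N -> connect (adjacent T) x y.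
    move=> x0; have [->//|xy] := eqVneq x y.
    apply: connect1; rewrite /adjacent inT x0 eqxx ltn_ord andbT /=.
    rewrite lt0n (_ : _ != _)//; apply: contraNneq xy => y0.
    by apply/eqP/val_inj; rewrite /= x0 y0.
  have sym : connect_sym (@adjacent n T).
    by apply: sym_connect_sym => x y; rewrite /adjacent orbC.
  case: n T inT to0 sym => [|n] T inT to0 sym x y; first by case: x.
  by apply: (@connect_trans _ _ ord0); [rewrite sym|]; exact: to0.
- have adj0 (x y : 'I_n) : adjacent T x y -> val x <> 0%N -> val y = 0%N.
    by rewrite /adjacent !inT => /orP[/andP[/eqP->]//|/andP[/eqP->]].
  have inj0 (x y : 'I_n) : val x = 0%N -> val y = 0%N -> x = y.
    by move=> x0 y0; apply: val_inj; rewrite x0 y0.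
  case=> [|x [|y [|z c]]] // _ /andP[/= /and3P[xy yz zc]].
  rewrite !inE !negb_or => /and4P[/and3P[xNy xNz xc] /andP[yNz yc] zNc _].
  have y0 : val y = 0%N.
    case: (eqVneq (val y) 0%N) => // /eqP yn0.
    have z0 := adj0 _ _ yz yn0.
    have x0 : val x = 0%N by apply: (adj0 y) => //; rewrite /adjacent orbC.
    by rewrite (inj0 _ _ x0 z0) eqxx in xNz.
  have zn0 : val z <> 0%N by move=> z0; rewrite (inj0 _ _ y0 z0) eqxx in yNz.
  case: c zc xc yc zNc => [|w c] /= /andP[zw _] _ yc _.
    by rewrite (inj0 _ _ (adj0 _ _ zw zn0) y0) eqxx in xNy.
  by move: yc; rewrite (inj0 _ _ (adj0 _ _ zw zn0) y0) inE eqxx.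
Qed.

Lemma minimum_spanning_tree_exists (R : realType) (X : metricType R)
    (s : nat -> X) (n : nat) : exists T, minimum_spanning_tree s n T.
Proof.
pose K : edge_set := [fset (a, b) | a : nat in iota 0 n, b : nat in iota 0 n]%fset.
have subK T : spanning_tree n T -> T \in fpowerset K.
  case=> Tn _ _; rewrite fpowersetE; apply/fsubsetP => -[a b] /Tn /andP[ab bn].
  apply/imfset2P; exists a; first by rewrite mem_iota /= add0n (ltn_trans ab bn).
  by exists b => //; rewrite mem_iota.
pose T0 : fpowerset K := [` subK _ (star_spanning_tree n)]%fset.
case: (@arg_minP _ _ _ T0 (fun T => `[< spanning_tree n (val T) >])
  (fun T => weight s (val T))) => [|T /asboolP Tt Tmin].
  by apply/asboolP; exact: star_spanning_tree.
exists (val T); split => // T' T't.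
by apply: (Tmin [` subK _ T't]%fset); apply/asboolP.
Qed.

Lemma generated_by_exists (R : realType) (X : metricType R)
    (A : online_algorithm R) (adv : adversary X) :
  exists s, generated_by A adv s.
Proof.
pose hist (s : nat -> X) k := [seq current_matching A s i | i <- iota 1 k].
pose next (s : nat -> X) k j := if j == k.*2 then (adv (hist s k)).1
  else if j == k.*2.+1 then (adv (hist s k)).2 else s j.
pose fix g k := if k is k'.+1 then next (g k') k' else fun=> (adv [::]).1.
have gS k j : (j < k.*2)%N -> g k.+1 j = g k j.
  by move=> jk; rewrite /= /next !ltn_eqF// ltnW.
have gD k l j : (j < k.*2)%N -> g (k + l)%N j = g k j.
  move=> jk; elim: l => [|l <-]; rewrite ?addn0// addnS gS//.
  by rewrite (leq_trans jk)// leq_double leq_addr.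
pose s j := g (j./2).+1 j.
have sE k j : (j < k.*2)%N -> s j = g k j.
  move=> jk; have jk2 : ((j./2).+1 <= k)%N.
    rewrite ltnNge -leq_double -ltnNge (leq_ltn_trans _ jk)//.
    by rewrite -[leqRHS]odd_double_half leq_addl.
  rewrite -(subnKC jk2) gD// doubleS -[ltnLHS]odd_double_half.
  by rewrite -addn2 addnC ltn_add2l; case: (odd j).
have histE k : hist s k = hist (g k) k.
  apply/seq.eq_in_map => i; rewrite mem_iota add1n ltnS => /andP[i0 ik].
  case: i i0 ik => // i _ ik; rewrite /current_matching; congr (A _ _).
  apply/matrixP => a b; rewrite !mxE.
  by rewrite !(sE k)// (leq_trans (ltn_ord _))// leq_double.
exists s => k; rewrite -/(hist s k) histE.
rewrite !(sE k.+1) ?doubleS// [LHS]/= /next eqxx gtn_eqF// eqxx.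
by rewrite -surjective_pairing.
Qed.

Lemma every_sequence_generated (R : realType) (X : metricType R)
    (A : online_algorithm R) (s : nat -> X) :
  exists adv : adversary X, generated_by A adv s.
Proof.
exists (fun h => (s (size h).*2, s (size h).*2.+1)) => k.
by rewrite size_map size_iota.
Qed.

(* Main.v *)
Require Import Defs.
From HB Require Import structures.
From mathcomp Require Import all_boot all_order all_algebra.
From mathcomp Require Import finmap.
From mathcomp Require Import all_classical all_reals all_analysis.
From mathcomp Require Import ring lra zify.

Set Implicit Arguments.
Unset Strict Implicit.
Unset Printing Implicit Defensive.
Import Order.TTheory GRing.Theory Num.Theory.
Local Open Scope ring_scope.

(* Every new point p is attached to the nearest earlier point q with
   2 d(p,q) <= lam q (the first point is always allowed), and lam p := d(p,q).
   The largest lam on the tree path between two points is an ultrametric u that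
   never changes, and d <= 4u because lam doubles along chains of parents.  The
   centers at scale r, i.e. the root and the points with lam > r, are
   r/2-separated, so there are O(1 + MST/r) of them, and every point is at
   u-distance at most r from one of them.

   A matching is improved by exchanging two edges e, e' for e.1e'.1 and e.2e'.2
   when 2 u(e.1,e'.1) <= min(u e, u e').  Then no scale gets worse: for every
   rho <= min(u e, u e'), the potential of rho, which counts over all edges the
   scales 2^j rho they reach, drops by at least 1.  If no exchange is available
   above rho, the edges with u >= 2^j rho have their first endpoints in distinct
   clusters of scale 2^(j-1) rho, which bounds the potential by the number of
   centers.  A new pair raises the potential of rho by at most
   J = log(diameter/rho) + O(1), so O(log n) exchanges per pair, largest scale
   first, keep it O(MST/rho): this is clear once the budget exceeds J, and
   before that there are fewer than 2^(J/2) edges, each of height at most J.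
   Hence O(MST/rho) edges have u >= rho, and summing over the log n dyadic scales
   below the diameter gives the weight bound. *)

(** * Variation along a connected edge set and the weight of separated points *)

(** A simple path from [x] to [y] uses each edge at most once, so the triangle inequality along it
    charges each edge at most once. *)
Lemma connect_variation (R : realType) (f : nat -> R) (n : nat) (E : edge_set)
    (x y : 'I_n) : connect (Defs.adjacent E) x y ->
  `|f x - f y| <= \sum_(e <- E) `|f e.1 - f e.2|.
Proof.
case/connectP=> p; case/shortenP=> {}p xp Up _ ->.
elim: p x E xp Up => [|z p IH] x E /=.
  by rewrite subrr normr0 => _ _; apply: sumr_ge0.
case/andP=> xz zp /andP[xNp Up].
have [e eE fe] : exists2 e, e \in E &
    `|f e.1 - f e.2| = `|f x - f z| /\ incident x e.
  by case/orP: xz => ?; [exists (val x, val z)|exists (val z, val x)] => //;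
    split; rewrite /incident /= ?eqxx ?orbT// distrC.
rewrite (big_fsetD1 e)//= (le_trans (ler_distD (f z) _ _))//.
rewrite fe.1 lerD2l; apply: IH => //.
(* The rest of the path avoids [x], so it survives the removal of [e], which is incident to [x]. *)
have/(@sub_in_path _ [pred v | v != x])-> // : {in [pred v | v != x] &,
    subrel (@Defs.adjacent n E) (@Defs.adjacent n (E `\ e)%fset)}.
  have vE a b : a != x -> b != x -> (val a, val b) != e.
    move=> ax bx; apply: contraTneq fe.2 => <-.
    by rewrite /incident /= !(eq_sym (nat_of_ord x)) negb_or ax.
  move=> a b ax bx; rewrite /Defs.adjacent.
  case/orP=> [abE|baE]; apply/orP; [left|right].
    by rewrite in_fsetD1 abE andbT; exact: vE.
  by rewrite in_fsetD1 baE andbT; exact: vE.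
by apply/allP => v vp; rewrite inE; apply: contraNneq xNp => <-.
Qed.

Lemma count_le1 (T : eqType) (P : pred T) (s : seq T) :
  uniq s -> {in s &, forall x y, P x -> P y -> x = y} -> (count P s <= 1)%N.
Proof.
rewrite -size_filter => Us PP; case E: (seq.filter P s) => [|x [|y r]] //=.
have Uf := filter_uniq P Us.
have : x \in seq.filter P s by rewrite E !inE eqxx.
have : y \in seq.filter P s by rewrite E !inE eqxx orbT.
rewrite !mem_filter => /andP[Py ys] /andP[Px xs].
by move: Uf; rewrite E (PP x y xs ys Px Py) /= inE eqxx.
Qed.

(* The tests [min (d q) (delta / 2)], q in Q, each vary by at least [delta / 2]
   along the tree, and only two of them can vary along a given edge. *)
Lemma separated_weight (R : realType) (X : metricType R) (s : nat -> X)
    (n : nat) (T : edge_set) (Q : seq nat) (delta : R) :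
  (forall x y : 'I_n, connect (Defs.adjacent T) x y) ->
  {in Q, forall q, (q < n)%N} -> uniq Q -> 0 < delta ->
  {in Q &, forall p q, p != q -> delta <= mdist (s p) (s q)} ->
  (1 < size Q)%N -> (size Q)%:R * delta <= 4 * weight s T.
Proof.
move=> conn Qn UQ d0 sepQ sQ.
pose f q v := Num.min (mdist (s q) (s v)) (delta / 2).
pose w (e : nat * nat) := mdist (s e.1) (s e.2).
have w0 e : 0 <= w e by exact: mdist_ge0.
(* The test of [q] is 0 at [q] and [delta / 2] at every other point of [Q]; such a point exists
   because [1 < size Q]. *)
have fq q : q \in Q -> delta / 2 <= \sum_(e <- T) `|f q e.1 - f q e.2|.
  move=> qQ; have [q' q'Q qq'] : exists2 q', q' \in Q & q != q'.
    apply/hasP; rewrite has_predC; apply: contraL sQ => /allP QQ.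
    rewrite -leqNgt; have := @count_le1 _ xpredT _ UQ.
    by rewrite count_predT; apply=> x y /QQ/eqP<- /QQ/eqP<-.
  apply: le_trans (connect_variation (f q)
    (conn (Ordinal (Qn _ qQ)) (Ordinal (Qn _ q'Q)))).
  have d20 : 0 <= delta / 2 by rewrite divr_ge0// ltW.
  rewrite /f /= mdistxx (min_l d20) min_r; last first.
    by have := sepQ _ _ qQ q'Q qq'; lra.
  by rewrite sub0r normrN ger0_norm.
(* The test is 1-Lipschitz and constant outside the open ball of radius [delta / 2] about [q]; by
   separation a point lies in at most one of these balls ([c1]). *)
have fe e q : `|f q e.1 - f q e.2| <=
    w e *+ (mdist (s q) (s e.1) < delta / 2)%R +
    w e *+ (mdist (s q) (s e.2) < delta / 2)%R.
  have t1 := metric_triangle (s q) (s e.1) (s e.2).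
  have t2 := metric_triangle (s q) (s e.2) (s e.1).
  rewrite (metric_sym (s e.2)) in t2; have we := w0 e; rewrite /w in we *.
  rewrite /f /Num.min; case: ltP => h1; case: ltP => h2;
    rewrite ?mulr0n ?mulr1n;
    by rewrite ler_norml; apply/andP; split; lra.
have c1 v : (count (fun q => mdist (s q) (s v) < delta / 2)%R Q <= 1)%N.
  apply: count_le1 => // x y xQ yQ xv yv; apply/eqP; apply: contraT => xy.
  have := sepQ _ _ xQ yQ xy; have := metric_triangle (s x) (s v) (s y).
  by rewrite (metric_sym (s v)); lra.
have : \sum_(q <- Q) (delta / 2) <= \sum_(e <- T) w e *+ 2.
  apply: le_trans (_ : _ <= \sum_(q <- Q) \sum_(e <- T) `|f q e.1 - f q e.2|) _.
    by rewrite big_seq [leRHS]big_seq; apply: ler_sum.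
  rewrite exchange_big /=; apply: ler_sum => e _.
  apply: le_trans (ler_sum _ (fun q _ => fe e q)) _.
  rewrite big_split /= !sumrMnr mulr2n.
  have cE v : (\sum_(q <- Q) (mdist (s q) (s v) < delta / 2)%R <= 1)%N.
    rewrite (leq_trans _ (c1 v))// -sum1_count [leqRHS]big_mkcond.
    by rewrite leq_sum// => q _; case: ifP.
  by apply: lerD; rewrite -[leRHS]mulr1n ler_wpMn2l.
rewrite big_const_seq count_predT iter_addr_0 sumrMnl -/(weight s T).
  by rewrite -[_ *+ size Q]mulr_natl -[_ *+ 2]mulr_natl; lra.
Qed.

Lemma mdist_le_weight (R : realType) (X : metricType R) (s : nat -> X)
    (n : nat) (T : edge_set) (x y : nat) :
  (forall x y : 'I_n, connect (Defs.adjacent T) x y) ->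
  (x < n)%N -> (y < n)%N ->
  mdist (s x) (s y) <= weight s T.
Proof.
move=> conn xn yn.
have := connect_variation (fun v => mdist (s x) (s v))
  (conn (Ordinal xn) (Ordinal yn)).
rewrite /= mdistxx sub0r normrN ger0_norm ?mdist_ge0// => /le_trans; apply.
apply: ler_sum => e _; have := metric_triangle (s x) (s e.1) (s e.2).
have := metric_triangle (s x) (s e.2) (s e.1); rewrite (metric_sym (s e.2)).
by rewrite ler_norml => ? ?; apply/andP; split; lra.
Qed.

(** * The hierarchy of centers and its ultrametric *)

Section Hierarchy.
Variable R : realType.
Implicit Types (d u : nat -> nat -> R) (lam : nat -> R) (n : nat) (r : R).

(** Restricted to indices below [n], so that distances truncated at [n] qualify; distinct indices
    may be at distance 0. *)
Record semimetric_on d n : Prop := Semimetric {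
  smxx : forall x, (x < n)%N -> d x x = 0;
  smC : forall x y, (x < n)%N -> (y < n)%N -> d x y = d y x;
  smD : forall y x z, (y < n)%N -> (x < n)%N -> (z < n)%N ->
    d x z <= d x y + d y z }.

Lemma sm_ge0 d n x y : semimetric_on d n -> (x < n)%N -> (y < n)%N ->
  0 <= d x y.
Proof.
case=> xx C D xn yn; have := D y x x yn xn xn.
by rewrite xx// (C y x)//; lra.
Qed.

Definition center lam r h := (h == 0)%N || (r < lam h).

(* The slack [lam x] in [hi_center] pays for the edge to a child of [x], whose
   length is at most [lam x / 2]. *)
Record hierarchy d n lam u : Prop := Hierarchy {
  hi_xx : forall x, (x < n)%N -> u x x = 0;
  hi_sym : forall x y, (x < n)%N -> (y < n)%N -> u x y = u y x;
  hi_ultra : forall y x z, (y < n)%N -> (x < n)%N -> (z < n)%N ->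
    u x z <= Num.max (u x y) (u y z);
  hi_lam_ge0 : forall x, (x < n)%N -> 0 <= lam x;
  hi_lam_le : forall x y, (x < y < n)%N -> lam y <= u x y;
  hi_center : forall r x, 0 <= r -> (x < n)%N -> exists h,
    [/\ (h < n)%N, center lam r h, u x h <= r &
        h = x \/ d x h + lam x <= 2 * r];
  hi_sep : forall x y, (x < y < n)%N ->
    lam y <= d x y \/ (0 < x)%N /\ lam x < 2 * d x y;
  hi_bound : forall x y, (x < n)%N -> (y < n)%N ->
    exists a b, [/\ (a < n)%N, (b < n)%N & u x y <= d a b] }.

Lemma hi_ge0 d n lam u x y : hierarchy d n lam u -> (x < n)%N -> (y < n)%N ->
  0 <= u x y.
Proof.
move=> H xn yn; have := hi_ultra H yn xn xn.
by rewrite (hi_xx H)// (hi_sym H yn)// maxxx.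
Qed.

(** If [h < h'], then [r < lam h' <= u h h']: the later of two centers is too far from the earlier
    one. *)
Lemma center_unique d n lam u r h h' : hierarchy d n lam u ->
  (h < n)%N -> (h' < n)%N -> center lam r h -> center lam r h' ->
  u h h' <= r -> h = h'.
Proof.
move=> H hn hn' ch ch' uhh'.
wlog hh' : h h' hn hn' ch ch' uhh' / (h < h')%N.
  move=> th; case: (ltngtP h h') => [hh'|hh'|//]; first exact: th.
  by apply/esym/th => //; rewrite (hi_sym H).
have := hi_lam_le H (x := h) (y := h'); rewrite hh' hn' => /(_ isT) le.
move: ch'; rewrite /center gtn_eqF ?(leq_ltn_trans _ hh')//= => lt.
by have := lt_le_trans lt (le_trans le uhh'); rewrite ltxx.
Qed.

(** At scale [u x y] both points have the same center, by [center_unique], and each is within twice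
    that scale of it; hence the factor 4. *)
Lemma hi_dominates d n lam u x y : semimetric_on d n -> hierarchy d n lam u ->
  (x < n)%N -> (y < n)%N -> d x y <= 4 * u x y.
Proof.
move=> S H xn yn; have u0 := hi_ge0 H xn yn.
have [h [hn ch xh dxh]] := hi_center H u0 xn.
have [h' [hn' ch' yh' dyh']] := hi_center H u0 yn.
have near v w : (v < n)%N -> (w < n)%N -> w = v \/ d v w + lam v <= 2 * u x y ->
    d v w <= 2 * u x y.
  move=> vn wn [->|]; first by rewrite (smxx S)// mulr_ge0.
  by have := hi_lam_ge0 H vn; lra.
have E : h = h'.
  apply: (center_unique H hn hn' ch ch').
  rewrite (le_trans (hi_ultra H xn hn hn'))// ge_max (hi_sym H)// xh /=.
  by rewrite (le_trans (hi_ultra H yn xn hn'))// ge_max lexx.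
rewrite -E in dyh'; have := near _ _ xn hn dxh; have := near _ _ yn hn dyh'.
by have := smD S hn xn yn; rewrite (smC S hn yn); lra.
Qed.

(** For [x < y], [hi_sep] gives [r < lam y <= d x y], or a non-root [x] with
    [r < lam x < 2 * d x y]; the second case costs the factor 2. *)
Lemma center_separated d n lam u r x y : semimetric_on d n ->
  hierarchy d n lam u -> 0 <= r -> (x < n)%N -> (y < n)%N ->
  center lam r x -> center lam r y -> x != y -> r / 2 <= d x y.
Proof.
move=> S H r0 xn yn cx cy xy.
wlog lxy : x y xn yn cx cy xy / (x < y)%N.
  move=> th; move: (xy); rewrite neq_ltn => /orP[?|?]; first exact: th.
  by rewrite (smC S)// th// eq_sym.
have y0 : (y == 0)%N = false by rewrite gtn_eqF// (leq_ltn_trans _ lxy).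
move: cy; rewrite /center y0 /= => ry.
have := hi_sep H (x := x) (y := y); rewrite lxy yn => /(_ isT) [|[x0]].
  by have := sm_ge0 S xn yn; lra.
by move: cx; rewrite /center gtn_eqF//=; lra.
Qed.

(** For passing between the true distances and those truncated to the revealed points. *)
Lemma hierarchy_congr d d' n lam u :
  (forall a b, (a < n)%N -> (b < n)%N -> d a b = d' a b) ->
  hierarchy d n lam u -> hierarchy d' n lam u.
Proof.
move=> dd' H; have lt2 x y : (x < y < n)%N -> (x < n)%N /\ (y < n)%N.
  by case/andP=> xy yn; split => //; exact: ltn_trans yn.
split=> //; try by case: H.
- move=> r x r0 xn; have [h [hn ? ?]] := hi_center H r0 xn.
  by rewrite dd'// => ?; exists h.
- move=> x y xy; have [xn yn] := lt2 _ _ xy.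
  by rewrite -dd'//; exact: hi_sep H _ _ xy.
- move=> x y xn yn; have [a [b [an bn]]] := hi_bound H xn yn.
  by rewrite dd'// => ?; exists a, b.
Qed.

Lemma semimetric_congr d d' n :
  (forall a b, (a < n)%N -> (b < n)%N -> d a b = d' a b) ->
  semimetric_on d n -> semimetric_on d' n.
Proof.
move=> dd' [xx C D].
by split=> *; rewrite -!dd'//; [exact: xx | exact: C | exact: D].
Qed.

Lemma hierarchy0 d lam u : hierarchy d 0 lam u.
Proof. by split=> // x y; rewrite andbF. Qed.

(** Values on old points are frozen, so arrivals leave the potential of the old edges unchanged. *)
Definition agree n lam u lam' u' :=
  (forall x, (x < n)%N -> lam' x = lam x) /\
  (forall x y, (x < n)%N -> (y < n)%N -> u' x y = u x y).

(* The new point [n] is attached to the nearest earlier [q] such that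
   [2 * d n q <= lam q]: thus [lam] at least doubles along a chain of parents,
   which keeps [u] within a constant factor of [d]. *)
Lemma hierarchy_extend d n lam u : semimetric_on d n.+1 ->
  hierarchy d n lam u ->
  exists lam' u', hierarchy d n.+1 lam' u' /\ agree n lam u lam' u'.
Proof.
case: n => [|n] S H.
  exists (fun=> 0), (fun _ _ => 0); split => //; split => //.
  - move=> r x r0; rewrite ltnS leqn0 => /eqP->.
    by exists 0%N; split => //; left.
  - by move=> x y; rewrite ltnS leqn0 andbC => /andP[/eqP->].
  - by move=> x y _ _; exists 0%N, 0%N; rewrite (smxx S).
pose N := n.+1; rewrite -/N in S H *.
pose ok (q : 'I_N) := (q == 0 :> nat) || (2 * d N q <= lam q).
have ok0 : ok ord0 by [].
case: (@arg_minP _ _ _ ord0 ok (fun q : 'I_N => d N q) ok0) => q okq qmin.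
have qN : (q < N)%N := ltn_ord q; set l := d N q.
have NS (x : nat) : (x < N)%N -> (x < N.+1)%N by move=> /ltnW.
have SN : (N < N.+1)%N by [].
have l0 : 0 <= l by rewrite /l (sm_ge0 S)// NS.
pose lam' x := if x == N then l else lam x.
pose u' x y := if x == N then (if y == N then 0 else Num.max l (u q y))
               else if y == N then Num.max l (u q x) else u x y.
have Nx (x : nat) : (x < N)%N -> (x == N) = false by move=> /ltn_eqF.
have caseN (x : nat) : (x < N.+1)%N -> x = N \/ (x < N)%N.
  by rewrite ltnS leq_eqVlt => /orP[/eqP|]; [left|right].
exists lam', u'; split; last first.
  by split=> [x xN|x y xN yN]; rewrite /lam' /u' !Nx.
split.
- by move=> x /caseN[->|xN]; rewrite /u' ?eqxx// !Nx// (hi_xx H).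
- by move=> x y /caseN[->|xN] /caseN[->|yN]; rewrite /u' ?eqxx ?Nx// (hi_sym H).
- move=> y x z /caseN[->|yN] /caseN[->|xN] /caseN[->|zN];
    rewrite /u' ?eqxx ?Nx//=.
  + by rewrite le_max lexx orbT.
  + by rewrite le_max lexx.
  + have := hi_ultra H qN xN zN; rewrite (hi_sym H xN qN) !le_max.
    by case/orP=> ->; rewrite ?orbT.
  + by rewrite !le_max l0.
  + have := hi_ultra H yN qN zN; rewrite ge_max !le_max lexx /=.
    by case/orP=> ->; rewrite ?orbT.
  + have := hi_ultra H yN qN xN; rewrite (hi_sym H yN xN) ge_max !le_max lexx.
    by rewrite orbT /= => /orP[]->; rewrite ?orbT.
  + exact: (hi_ultra H yN xN zN).
- by move=> x /caseN[->|xN]; rewrite /lam' ?eqxx ?Nx// (hi_lam_ge0 H).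
- move=> x y /andP[xy /caseN[yN|yN]]; rewrite /lam' /u'.
    subst y; rewrite eqxx Nx//=. by rewrite le_max lexx.
  by rewrite !Nx ?(ltn_trans xy)//; apply: (hi_lam_le H); rewrite xy.
- move=> r x r0 /caseN[->|xN]; last first.
    have [h [hN ch uh dh]] := hi_center H r0 xN.
    by exists h; rewrite /center /lam' /u' !Nx// NS.
  have [lr|rl] := ltP r l.
    by exists N; rewrite /center /lam' /u' eqxx lr orbT; split => //; left.
  have [q0|q0] := eqVneq (q : nat) 0%N.
    exists q; rewrite /lam' /u' eqxx Nx//=; split => //; first exact: NS.
    - by rewrite /center q0.
    - by rewrite ge_max rl (hi_xx H).
    - by right; rewrite -/l; lra.
  (* The center [h] of [q] also serves [N]: [d N h + l <= d q h + 2 * l <= d q h + lam q <= 2 * r],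
     or [2 * l <= 2 * r] when [h = q]. *)
  move: okq; rewrite /ok (negbTE q0) /= -/l => lq.
  have [h [hN ch uh dh]] := hi_center H r0 qN.
  exists h; rewrite /center /lam' /u' eqxx Nx//=; split => //; first exact: NS.
    by rewrite ge_max rl.
  right; case: dh => [->|dh]; first by rewrite -/l; lra.
  by have := smD S (NS _ qN) SN (NS _ hN); rewrite -/l; lra.
- move=> x y /andP[xy /caseN[yN|yN]]; rewrite /lam'.
    subst y; rewrite eqxx Nx// (smC S (NS _ xy))//.
    (* If [x] was allowed as parent, minimality of [q] gives [l <= d N x]; otherwise [x] is not the
       root and [lam x < 2 * d N x]. *)
    have [okx|] := boolP (ok (Ordinal xy)); first by left; exact: (qmin _ okx).
    by rewrite negb_or -lt0n -ltNge => /andP[x0 lt]; right.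
  by rewrite !Nx ?(ltn_trans xy)//; apply: (hi_sep H); rewrite xy.
- have bnd x : (x < N)%N -> exists a b,
    [/\ (a < N.+1)%N, (b < N.+1)%N & Num.max l (u q x) <= d a b].
    move=> xN; have [a [b [aN bN ab]]] := hi_bound H qN xN.
    have [ul|lu] := lerP (u q x) l.
      by exists N, (q : nat); split => //; exact: NS.
    by exists a, b; split; [exact: NS|exact: NS|].
  move=> x y /caseN[->|xN] /caseN[->|yN]; rewrite /u' ?eqxx ?Nx//;
    try exact: bnd.
    by exists N, N; rewrite (smxx S).
  have [a [b [aN bN ab]]] := hi_bound H xN yN.
  by exists a, b; rewrite !NS.
Qed.

Definition centers lam n r := count (center lam r) (iota 0 n).

Lemma leq_centers lam lam' m n r : (m <= n)%N ->
  (forall x, (x < m)%N -> lam' x = lam x) ->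
  (centers lam m r <= centers lam' n r)%N.
Proof.
move=> mn E; rewrite /centers -(subnKC mn) iotaD count_cat.
rewrite (@seq.eq_in_count _ _ (center lam' r)) ?leq_addr// => x.
by rewrite mem_iota /= add0n /center => /E->.
Qed.

(** Centers are [r / 2]-separated, so [separated_weight] applies once there are two of them; the
    summand 1 covers a single center. *)
Lemma centers_le (X : metricType R) (s : nat -> X) n lam u (T : edge_set) r :
  let d a b := mdist (s a) (s b) in
  semimetric_on d n -> hierarchy d n lam u ->
  (forall x y : 'I_n, connect (Defs.adjacent T) x y) ->
  0 < r -> (centers lam n r)%:R <= 1 + 8 * weight s T / r.
Proof.
move=> d S H conn r0; set W := weight s T.
have W0 : 0 <= W by apply: sumr_ge0 => e _; exact: mdist_ge0.
pose Q := [seq h <- iota 0 n | center lam r h].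
have -> : centers lam n r = size Q by rewrite size_filter.
have memQ h : h \in Q -> center lam r h /\ (h < n)%N.
  by rewrite mem_filter mem_iota add0n => /andP[].
have [sQ|sQ] := leqP (size Q) 1.
  rewrite -[leLHS]addr0 lerD ?ler1n ?ler_nat ?ler1n//.
    by rewrite (ler_nat R _ 1).
  by rewrite divr_ge0 ?mulr_ge0// ltW.
have r20 : 0 < r / 2 by rewrite divr_gt0.
  have := @separated_weight R X s n T Q (r / 2) conn.
have Qn : {in Q, forall q, (q < n)%N} by move=> q /memQ[].
have sep : {in Q &, forall p q, p != q -> r / 2 <= mdist (s p) (s q)}.
  move=> p q /memQ[cp pn] /memQ[cq qn] pq.
  by apply: (center_separated S H _ pn qn cp cq pq); exact: ltW.
have UQ : uniq Q by rewrite filter_uniq// iota_uniq.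
move=> /(_ Qn UQ r20 sep sQ) h.
apply: (@le_trans _ _ (8 * W / r)); last by rewrite lerDr.
by rewrite ler_pdivlMr//; rewrite -/W in h; lra.
Qed.

End Hierarchy.

(** * Perfect matchings as sequences of pairs, and exchanges of edges *)

(** A loop has degree 2 at its vertex, so requiring total degree 1 excludes loops. *)
Definition deg (v : nat) (e : nat * nat) : nat := ((v == e.1) + (v == e.2))%N.

(* Perfect matchings on [{0, .., n-1}], without orienting the edges. *)
Definition pairing (n : nat) (M : seq (nat * nat)) : Prop :=
  (forall e, e \in M -> (e.1 < n)%N /\ (e.2 < n)%N) /\
  (forall v, (v < n)%N -> (\sum_(e <- M) deg v e = 1)%N).

Definition orient (e : nat * nat) := (minn e.1 e.2, maxn e.1 e.2).

Definition edges_of (M : seq (nat * nat)) : edge_set :=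
  [fset orient e | e in M]%fset.

Lemma edges_ofP M e :
  reflect (exists2 f, f \in M & e = orient f) (e \in edges_of M).
Proof. exact: imfsetP. Qed.

Lemma edges_of_cons e M : edges_of (e :: M) = (orient e |` edges_of M)%fset.
Proof.
apply/fsetP => f; rewrite in_fset1U; apply/edges_ofP/orP.
  case=> g; rewrite inE => /orP[/eqP->|gM] ->; first by left.
  by right; apply/edges_ofP; exists g.
by case=> [/eqP->|/edges_ofP[g gM ->]]; [exists e|exists g];
  rewrite // inE ?eqxx ?gM ?orbT.
Qed.

Lemma incident_orient v e : incident v (orient e) = (0 < deg v e)%N.
Proof.
rewrite /incident /orient /deg /= /minn /maxn addn_gt0 !lt0b.
by case: ltnP => // _; rewrite orbC.
Qed.

Lemma pairing_uniq n M : pairing n M -> uniq M.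
Proof.
case=> Mn Md; apply: count_mem_uniq => e.
have [eM|eM] := boolP (e \in M); last by apply/count_memPn.
apply/eqP; rewrite eqn_leq -[(true <= _)%N]has_count has_pred1 eM andbT /=.
rewrite -(Md e.1 (Mn e eM).1) -sum1_count big_mkcond leq_sum// => e' _.
by rewrite /=; case: (e' =P e) => [->|_ //]; rewrite /deg eqxx.
Qed.

Lemma pairing_incident n M e e' v : pairing n M -> e \in M -> e' \in M ->
  (v < n)%N -> (0 < deg v e)%N -> (0 < deg v e')%N -> e = e'.
Proof.
move=> [_ Md] eM e'M vn dv dv'; apply/eqP; apply: contraT => ee'.
have e'r : e' \in rem e M by apply: rem_mem; rewrite // eq_sym.
have := Md v vn; rewrite (big_rem e)//= (big_rem e')//=.
move: (deg v e) (deg v e') dv dv' => [|a] [|b] //.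
by rewrite !addSn !addnS.
Qed.

Lemma pairing_irrefl n M e : pairing n M -> e \in M -> e.1 != e.2.
Proof.
move=> [Mn Md] eM; apply/eqP => e12.
have := Md e.1 (Mn e eM).1; rewrite (big_rem e)//= {1}/deg -e12 eqxx.
by rewrite !addSn.
Qed.

Lemma perfect_edges_of n M : pairing n M -> perfect_matching n (edges_of M).
Proof.
move=> MP; have [Mn Md] := MP; split.
  move=> _ /edges_ofP[e eM ->]; have [e1 e2] := Mn e eM.
  have := pairing_irrefl MP eM; rewrite neq_ltn gtn_max e1 e2 !andbT /=.
  by rewrite /minn /maxn; case: ltnP => //= _ /orP[].
move=> v vn; have := Md v vn.
have [/hasP[e eM dv] _|/hasPn M0] := boolP (has (fun e => 0 < deg v e)%N M).
  exists (orient e); split.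
    by rewrite incident_orient dv andbT; apply/edges_ofP; exists e.
  move=> _ /andP[/edges_ofP[e' e'M ->]]; rewrite incident_orient => dv'.
  by rewrite (pairing_incident MP eM e'M vn dv dv').
by rewrite big_seq big1// => e /M0; rewrite lt0n negbK => /eqP.
Qed.

(** Only an inequality, since several pairs of [M] may orient to the same edge. *)
Lemma sum_edges_of_le (R : realType) (M : seq (nat * nat))
    (F : nat * nat -> R) : (forall e, 0 <= F e) ->
  (\sum_(e <- edges_of M) F e <= \sum_(e <- M) F (orient e)).
Proof.
move=> F0; elim: M => [|e M IH].
  rewrite big_nil (_ : edges_of [::] = fset0) ?big_seq_fset0//.
  by apply/fsetP => f; rewrite in_fset0; apply/edges_ofP => -[].
rewrite edges_of_cons big_cons.
have [eM|eM] := boolP (orient e \in edges_of M).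
  have -> : (orient e |` edges_of M)%fset = edges_of M.
    by apply/fsetP => f; rewrite in_fset1U; case: eqP => // ->; rewrite eM.
  by rewrite (le_trans IH)// lerDr.
by rewrite big_fsetU1//= lerD2l.
Qed.

Lemma size_pairing n M : pairing n M -> (size M).*2 = n.
Proof.
case=> Mn Md.
have : (\sum_(v < n) \sum_(e <- M) deg v e = n)%N.
  by under eq_bigr => v _ do rewrite Md//; rewrite sum1_card card_ord.
rewrite exchange_big /= big_seq (eq_bigr (fun=> 2%N)) => [|e eM].
  by rewrite -big_seq big_const_seq count_predT iter_addn_0 mul2n => <-.
have [e1 e2] := Mn e eM; rewrite big_split /=.
have one a : (a < n)%N -> (\sum_(v < n) (v == a :> nat) = 1)%N.
  move=> an; rewrite (bigD1 (Ordinal an))//= eqxx big1// => v va.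
  by rewrite -val_eqE /= in va; rewrite (negbTE va).
by rewrite !one.
Qed.

Definition swap (e e' : nat * nat) M := [:: (e.1, e'.1), (e.2, e'.2) & M].

Lemma pairing_swap n M e e' M0 : pairing n M -> perm_eq M [:: e, e' & M0] ->
  pairing n (swap e e' M0).
Proof.
move=> [Mn Md] P; have MP := perm_mem P; split => [f|v vn].
  have [e1 e2] : (e.1 < n)%N /\ (e.2 < n)%N by apply: Mn; rewrite MP !inE eqxx.
  have [e1' e2'] : (e'.1 < n)%N /\ (e'.2 < n)%N.
    by apply: Mn; rewrite MP !inE eqxx orbT.
  rewrite !inE => /or3P[/eqP->|/eqP->|fM] //=.
  by apply: Mn; rewrite MP !inE fM !orbT.
have := Md v vn; rewrite (perm_big _ P) /swap !big_cons /deg /=.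
by move=> <-; rewrite !addnA; congr (_ + _)%N; lia.
Qed.

Lemma recourse_swap M e e' M0 : perm_eq M [:: e, e' & M0] ->
  (recourse (edges_of M) (edges_of (swap e e' M0)) <= 2)%N.
Proof.
move=> P; rewrite /recourse.
apply: leq_trans (_ : (#|` [fset orient e; orient e']%fset| <= 2)%N).
  apply/fsubset_leq_card/fsubsetP => f; rewrite !inE => /andP[fN /edges_ofP[g]].
  rewrite (perm_mem P) !inE => /or3P[/eqP-> ->|/eqP-> ->|gM fE];
    rewrite ?eqxx ?orbT//.
  by case/edges_ofP: fN; exists g => //; rewrite !inE gM !orbT.
by rewrite cardfs2; case: (_ != _).
Qed.

Lemma recourse_trans (M1 M2 M3 : edge_set) :
  (recourse M1 M3 <= recourse M1 M2 + recourse M2 M3)%N.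
Proof.
rewrite /recourse.
apply: leq_trans (_ : (#|` ((M1 `\` M2) `|` (M2 `\` M3))%fset| <= _)%N).
  apply/fsubset_leq_card/fsubsetP => f; rewrite !inE => /andP[-> ->].
  by case: (f \in M2).
by rewrite cardfsU leq_subr.
Qed.

(** * Potentials of scales and their decrease under exchanges *)

Section Potential.
Variable R : realType.
Implicit Types (d u : nat -> nat -> R) (lam : nat -> R) (n J : nat).
Implicit Types (r rho : R) (M : seq (nat * nat)).

Definition height rho J (x : R) : nat := (\sum_(j < J) (2 ^+ j * rho <= x)%R)%N.

Definition potential u rho J M : nat :=
  (\sum_(e <- M) height rho J (u e.1 e.2))%N.

(** The level-by-level bound of [count_le_centers], summed over the [J] levels. *)
Definition capacity lam n rho J : nat :=
  (\sum_(j < J) centers lam n (2 ^+ j * rho / 2))%N.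

Lemma le_height rho J (x y : R) : x <= y ->
  (height rho J x <= height rho J y)%N.
Proof.
move=> xy; apply: leq_sum => j _.
by case: leP => // /le_trans/(_ xy)->.
Qed.

Lemma height_le rho J (x : R) : (height rho J x <= J)%N.
Proof.
rewrite -[leqRHS]card_ord -sum1_card; apply: leq_sum => j _; exact: leq_b1.
Qed.

(** Doubling maps the scales reached by [x] to scales above [rho] reached by [y], and [rho] itself
    is extra; [y < 2 ^+ J * rho] keeps all of them below level [J]. *)
Lemma height_half rho J (x y : R) : 2 * x <= y -> y < 2 ^+ J * rho ->
  (height rho J x + (rho <= y)%R <= height rho J y)%N.
Proof.
move=> xy yJ; apply: (@leq_trans (height rho J.+1 y)); last first.
  by rewrite /height big_ord_recr /= leNgt yJ addn0.
rewrite /height big_ord_recl /= expr0 mul1r addnC leq_add2l.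
apply: leq_sum => j _; case: (leP _ x) => // jx.
by rewrite /bump /= add1n exprS -mulrA (le_trans _ xy)// ler_pM2l.
Qed.

Lemma potential_exchange u rho J M : potential u rho J M =
  (\sum_(j < J) count (fun e : nat * nat => 2 ^+ j * rho <= u e.1 e.2)%R M)%N.
Proof.
rewrite /potential /height exchange_big; apply: eq_bigr => j _.
by rewrite -sum1_count [RHS]big_mkcond; apply: eq_bigr => e _; case: (_ <= _).
Qed.

(** In [u], [(e.1, e'.1)] is at most half the shorter old edge, which frees a level when [rho <= m];
    by the ultrametric inequality [(e.2, e'.2)] is at most the longer one. *)
Lemma potential_swap d n lam u rho J M e e' M0 : hierarchy d n lam u ->
  pairing n M -> perm_eq M [:: e, e' & M0] ->
  let m := Num.min (u e.1 e.2) (u e'.1 e'.2) in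
  2 * u e.1 e'.1 <= m -> m < 2 ^+ J * rho ->
  (potential u rho J (swap e e' M0) + (rho <= m)%R <= potential u rho J M)%N.
Proof.
move=> H [Mn _] P m um mJ; rewrite /potential (perm_big _ P) /swap !big_cons /=.
have [e1 e2] : (e.1 < n)%N /\ (e.2 < n)%N.
  by apply: Mn; rewrite (perm_mem P) !inE eqxx.
have [e1' e2'] : (e'.1 < n)%N /\ (e'.2 < n)%N.
  by apply: Mn; rewrite (perm_mem P) !inE eqxx orbT.
set a := u e.1 e.2 in m um mJ *; set b := u e'.1 e'.2 in m um mJ *.
have x0 := hi_ge0 H e1 e1'.
have y_le : u e.2 e'.2 <= Num.max a b.
  have := hi_ultra H e1' e2 e2'; have := hi_ultra H e1 e2 e1'.
  rewrite (hi_sym H e2 e1) -/a -/b; move: um; rewrite /m !(le_max, le_min).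
  case/andP=> ua ub /orP[h1|h1] /orP[h2|h2]; apply/orP;
    by [left; lra | right; lra].
have {}y_le := le_height rho J y_le; have := height_half um mJ.
have : (height rho J a + height rho J b =
    height rho J m + height rho J (Num.max a b))%N.
  by rewrite /m; have [] := leP a b; rewrite // addnC.
lia.
Qed.

Lemma seq_argmax (T : eqType) (F : T -> R) (P : pred T) (s : seq T) :
  {in s, forall x, ~~ P x} \/
  exists x, [/\ x \in s, P x & {in s, forall y, P y -> F y <= F x}].
Proof.
elim: s => [|x s [IH|[z [zs Pz zmax]]]]; first by left.
  have [Px|Px] := boolP (P x); [right; exists x|left].
    split; rewrite ?inE ?eqxx// => y.
    by rewrite inE => /orP[/eqP->//|/IH/negbTE->].
  by move=> y; rewrite inE => /orP[/eqP->|/IH].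
right; have [xz|zx] := boolP (P x && (F z <= F x)).
  case/andP: xz => Px zx; exists x; split; rewrite ?inE ?eqxx// => y.
  rewrite inE => /orP[/eqP->//|ys Py]; exact: le_trans (zmax _ ys Py) zx.
exists z; split; rewrite ?inE ?zs ?orbT// => y; rewrite inE => /orP[/eqP-> Px|].
  by move: zx; rewrite Px /= -ltNge => /ltW.
exact: zmax.
Qed.

Definition gap u (p : (nat * nat) * (nat * nat)) : R :=
  Num.min (u p.1.1 p.1.2) (u p.2.1 p.2.2).

Definition close u M (p : (nat * nat) * (nat * nat)) : bool :=
  (p.2 \in rem p.1 M) && (2 * u p.1.1 p.2.1 <= gap u p).

(** Send an edge to a center within [r / 2] of its first endpoint. Two long edges sharing a center
    would form a close pair of gap at least [r], so the map is injective. *)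
Lemma count_le_centers d n lam u r M : hierarchy d n lam u -> pairing n M ->
  0 <= r -> {in M &, forall e e', close u M (e, e') -> gap u (e, e') < r} ->
  (count (fun e : nat * nat => r <= u e.1 e.2)%R M <= centers lam n (r / 2))%N.
Proof.
move=> H MP r0 far; have [Mn _] := MP; have UM := pairing_uniq MP.
have r20 : 0 <= r / 2 by rewrite divr_ge0.
pose Mr := [seq e <- M | r <= u e.1 e.2].
have memMr e : e \in Mr -> e \in M /\ r <= u e.1 e.2.
  by rewrite mem_filter => /andP[].
have hP e : e \in M -> exists h,
    [/\ (h < n)%N, center lam (r / 2) h & u e.1 h <= r / 2].
  by case/Mn=> e1 _; have [h [? ? ? _]] := hi_center H r20 e1; exists h.
pose h e :=
  if pselect (e \in M) is left eM then projT1 (cid (hP e eM)) else 0%N.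
have hE e : e \in M -> [/\ (h e < n)%N, center lam (r / 2) (h e) &
    u e.1 (h e) <= r / 2].
  by move=> eM; rewrite /h; case: pselect => // {}eM; case: cid.
rewrite -size_filter -/Mr -(size_map h) /centers -size_filter.
apply: uniq_leq_size; last first.
  move=> _ /mapP[e /memMr[eM _] ->]; have [? ? _] := hE e eM.
  by rewrite mem_filter mem_iota; apply/andP; split.
rewrite map_inj_in_uniq ?filter_uniq// => e e' /memMr[eM re] /memMr[e'M re'] hh.
apply/eqP; apply: contraT => ee'.
have [hn _ uh] := hE e eM; have [_ _ uh'] := hE e' e'M; rewrite -hh in uh'.
have [e1 _] := Mn e eM; have [e1' _] := Mn e' e'M.
have ru : u e.1 e'.1 <= r / 2.
  by rewrite (le_trans (hi_ultra H hn e1 e1'))// ge_max uh (hi_sym H).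
have rg : r <= gap u (e, e') by rewrite /gap le_min re.
have : close u M (e, e').
  by rewrite /close rem_mem 1?eq_sym//=; apply: le_trans rg; lra.
by move/(far _ _ eM e'M); rewrite ltNge rg.
Qed.

(** The [J] levels reach past every distance, hence past every value of [u] by [hi_bound], so no
    height is cut off. *)
Definition scales d n rho J :=
  0 < rho /\ forall a b, (a < n)%N -> (b < n)%N -> d a b < 2 ^+ J * rho.

(** Exchange a close pair of maximal gap. Scales up to the gap lose potential; above it no close
    pair remains, so [count_le_centers] applies. One choice thus serves all [rho] at once. *)
Lemma best_exchange d n lam u M : hierarchy d n lam u -> pairing n M ->
  exists M', [/\ pairing n M', (recourse (edges_of M) (edges_of M') <= 2)%N &
    forall rho J, scales d n rho J ->
      (potential u rho J M' <= potential u rho J M)%N /\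
      ((potential u rho J M' < potential u rho J M)%N \/
       (potential u rho J M' <= capacity lam n rho J)%N)].
Proof.
move=> H MP; have [Mn _] := MP.
have uJ rho J x y : scales d n rho J -> (x < n)%N -> (y < n)%N ->
    u x y < 2 ^+ J * rho.
  move=> [_ dJ] xn yn; have [a [b [an bn ab]]] := hi_bound H xn yn.
  exact: le_lt_trans ab (dJ _ _ an bn).
have small rho J : scales d n rho J ->
    {in M &, forall e e', close u M (e, e') -> gap u (e, e') < rho} ->
    (potential u rho J M <= capacity lam n rho J)%N.
  move=> [r0 _] far; rewrite potential_exchange; apply: leq_sum => j _.
  apply: (count_le_centers H MP); first by rewrite mulr_ge0 ?exprn_ge0// ltW.
  move=> e e' eM e'M /(far _ _ eM e'M)/lt_le_trans; apply.
  by rewrite ler_peMl ?(ltW r0)// exprn_ege1// ler1n.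
case: (@seq_argmax _ (gap u) (close u M) [seq (e, e') | e <- M, e' <- M]).
  move=> none; exists M; split => //; first by rewrite /recourse fsetDv cardfs0.
  move=> rho J sc; split => //; right; apply: small => // e e' eM e'M c.
  by have := none (e, e') (allpairs_f _ eM e'M); rewrite c.
case=> -[e e'] [/allpairsP[[f f'] /= [eM e'M [? ?]]]]; subst f f'.
move=> c cmax; have /andP[/= e'r um] := c.
have P : perm_eq M [:: e, e' & rem e' (rem e M)].
  by rewrite (perm_trans (perm_to_rem eM))// perm_cons perm_to_rem.
exists (swap e e' (rem e' (rem e M))); split.
- exact: pairing_swap MP P.
- exact: recourse_swap.
move=> rho J sc; have [e1 e2] := Mn e eM.
have mJ : gap u (e, e') < 2 ^+ J * rho.
  by rewrite /gap /= gt_min (uJ rho J).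
have := potential_swap H MP P um mJ.
rewrite -/(gap u (e, e')); have [rg|gr] := leP rho (gap u (e, e')).
  by move=> lt; split; [lia | left; lia].
rewrite addn0 => le; split => //; right; apply: leq_trans le _.
apply: small => // f f' fM f'M /(cmax _ (allpairs_f _ fM f'M)) /le_lt_trans.
exact.
Qed.

(** Potentials never increase, so a scale that is within its capacity stays there. *)
Lemma exchanges d n lam u M k : hierarchy d n lam u -> pairing n M ->
  exists M', [/\ pairing n M', (recourse (edges_of M) (edges_of M') <= k.*2)%N &
    forall rho J, scales d n rho J ->
      (potential u rho J M' + k <= potential u rho J M)%N \/
      (potential u rho J M' <= capacity lam n rho J)%N].
Proof.
move=> H MP; elim: k => [|k [M1 [M1P rec1 pot1]]].
  exists M; split; rewrite ?/recourse ?fsetDv ?cardfs0// => rho J _.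
  by left; rewrite addn0.
have [M2 [M2P rec2 pot2]] := best_exchange H M1P; exists M2; split => //.
  rewrite (leq_trans (recourse_trans _ (edges_of M1) _))//.
  by rewrite doubleS -addn2 leq_add.
move=> rho J sc; have := pot1 rho J sc; have := pot2 rho J sc; lia.
Qed.

End Potential.

(** * The online algorithm and its invariant *)

Section Algorithm.
Variable R : realType.
Implicit Types (d u : nat -> nat -> R) (lam : nat -> R) (n k J : nat).
Implicit Types (rho : R) (M : seq (nat * nat)).

Record state := State {
  st_pairs : seq (nat * nat);
  st_lam : nat -> R;
  st_u : nat -> nat -> R }.

Definition budget k := (trunc_log 2 k.*2).*2.

(** The slack [2 * 2 ^ J] absorbs the scales whose [J] exceeds the budget. Multiplied by [rho] it is
    of the order of the diameter when [J] is chosen tightly. *)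
Definition good d k (st : state) : Prop :=
  [/\ pairing k.*2 (st_pairs st), hierarchy d k.*2 (st_lam st) (st_u st) &
    forall rho J, scales d k.*2 rho J ->
      (potential (st_u st) rho J (st_pairs st) <=
       capacity (st_lam st) k.*2 rho J + 2 * 2 ^ J)%N].

Definition advance d k (st st' : state) : Prop := good d k.+1 st' /\
  (recourse (edges_of (st_pairs st)) (edges_of (st_pairs st')) <=
   (budget k.+1).*2)%N.

Lemma scales_congr d d' n rho J :
  (forall a b, (a < n)%N -> (b < n)%N -> d a b = d' a b) ->
  scales d n rho J -> scales d' n rho J.
Proof. by move=> dd' [? dJ]; split=> // a b an bn; rewrite -dd'// dJ. Qed.

Lemma good_congr d d' k st :
  (forall a b, (a < k.*2)%N -> (b < k.*2)%N -> d a b = d' a b) ->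
  good d k st -> good d' k st.
Proof.
move=> dd' [MP H pot]; split => //; first exact: hierarchy_congr H.
by move=> rho J sc; apply: pot; apply: scales_congr sc => *; rewrite dd'.
Qed.

Lemma potential_le_size u rho J M : (potential u rho J M <= size M * J)%N.
Proof.
rewrite -[size M]sum1_size big_distrl /= /potential.
by apply: leq_sum => e _; rewrite mul1n height_le.
Qed.

(** With [h = J./2], [k <= 2 ^ h] and [J <= 2 * 2 ^ h], while [2 ^ h * 2 ^ h <= 2 ^ J]. *)
Lemma leq_mul_exp r k J : (k < 2 ^ r)%N -> (r.*2 < J)%N ->
  (k * J <= 2 * 2 ^ J)%N.
Proof.
move=> kr rJ; set h := J./2.
have Jh : (J <= h.*2.+1)%N.
  by rewrite -[leqLHS]odd_double_half -/h -add1n leq_add2r leq_b1.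
have rh : (r <= h)%N by rewrite /h -leq_double; lia.
have hh : (h < 2 ^ h)%N by rewrite ltn_expl.
have kh : (k <= 2 ^ h)%N by rewrite (leq_trans (ltnW kr))// leq_exp2l.
have JJ : (2 ^ h * 2 ^ h <= 2 ^ J)%N.
  by rewrite -expnD addnn leq_exp2l// -[leqRHS]odd_double_half leq_addl.
have : (J <= 2 * 2 ^ h)%N by lia.
move=> J2; apply: leq_trans (leq_mul kh J2) _; rewrite mulnCA; lia.
Qed.

Lemma semimetric_le d m n : (m <= n)%N -> semimetric_on d n ->
  semimetric_on d m.
Proof.
move=> mn [xx C D]; have le x : (x < m)%N -> (x < n)%N by move/leq_trans; apply.
by split=> *; [apply: xx | apply: C | apply: D]; apply: le.
Qed.

Lemma pairing_cons n M : pairing n M -> pairing n.+2 ((n, n.+1) :: M).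
Proof.
move=> [Mn Md]; split=> [e|v]; rewrite ?inE.
  case/orP=> [/eqP->//|/Mn[e1 e2]].
  by rewrite !leqW.
rewrite big_cons {1}/deg /= !ltnS leq_eqVlt => /orP[/eqP->|].
  rewrite eqxx gtn_eqF// big_seq big1// => e /Mn[e1 e2].
  by rewrite /deg !gtn_eqF// ltnS ltnW.
rewrite ltnS leq_eqVlt => /orP[/eqP->|vn]; last first.
  by rewrite Md// !ltn_eqF// ltnS ltnW.
rewrite eqxx ltn_eqF// big_seq big1// => e /Mn[e1 e2].
by rewrite /deg !gtn_eqF.
Qed.

Lemma advance_exists d k st : semimetric_on d k.+1.*2 -> good d k st ->
  exists st', advance d k st st'.
Proof.
case: st => M lam u S [/= MP H pot]; rewrite doubleS in S.
have [lam1 [u1 [H1 [lamE1 uE1]]]] :=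
  hierarchy_extend (semimetric_le (leqnSn _) S) H.
have [lam2 [u2 [H2 [lamE2 uE2]]]] := hierarchy_extend S H1.
have MP' := pairing_cons MP.
have [M' [M'P rec' pot']] := exchanges (budget k.+1) H2 MP'.
exists (State M' lam2 u2); split; last first.
  rewrite /= (leq_trans
    (recourse_trans _ (edges_of ((k.*2, k.*2.+1) :: M)) _))//.
  rewrite -[leqRHS]add0n leq_add// leqn0 cardfs_eq0.
  apply/eqP/fsetP => e; rewrite edges_of_cons in_fsetD in_fset1U in_fset0.
  by case: (e \in edges_of M); rewrite ?orbT ?andbF.
split => //=; rewrite doubleS => // rho J sc.
have cap : (capacity lam k.*2 rho J <= capacity lam2 k.*2.+2 rho J)%N.
  apply: leq_sum => j _; apply: leq_centers => [|x xk]; first by rewrite !leqW.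
  by rewrite lamE2 ?lamE1// ltnW.
case: (pot' rho J sc) => [dec|]; last by move/leq_trans; apply; exact: leq_addr.
(* For [J] within the budget, the exchanges offset the new edge, of height at most [J]. Otherwise
   the trivial bound, number of edges times [J], fits into the slack. *)
have [Jb|bJ] := leqP J (budget k.+1); last first.
  apply: leq_trans (leq_addl _ _).
  rewrite (leq_trans (potential_le_size _ _ _ _))//.
  apply: leq_mul_exp bJ.
  rewrite -ltn_double (size_pairing M'P) -doubleS -[ltnRHS]mul2n -expnS.
  exact: trunc_log_ltn.
have {}sc : scales d k.*2 rho J.
  by case: sc => r0 dJ; split=> // a b ak bk; apply: dJ; rewrite ltnW// ltnW.
have same : potential u2 rho J M = potential u rho J M.
  rewrite /potential big_seq [RHS]big_seq.
  apply: eq_bigr => e /(proj1 MP)[e1 e2].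
  by rewrite uE2 ?uE1// ltnW.
have := pot rho J sc; move: dec; rewrite {2}/potential big_cons /=.
rewrite -/(potential u2 rho J M) same.
have := height_le rho J (u2 k.*2 k.*2.+1); lia.
Qed.

Definition truncate n d a b := if (a < n)%N && (b < n)%N then d a b else 0.

(** A fixed choice function makes the algorithm deterministic; the default [st] is taken only when
    no valid successor exists, which [advance_exists] excludes along a run. *)
Definition next d k st :=
  if pselect (exists st', advance d k st st') is left h then projT1 (cid h)
  else st.

(* Truncating [d] makes the k-th choice depend on revealed distances only. *)
Fixpoint run d k : state :=
  if k is k'.+1 then next (truncate k.*2 d) k' (run d k')
  else State [::] (fun=> 0) (fun _ _ => 0).

Lemma truncate_lt n d a b : (a < n)%N -> (b < n)%N -> truncate n d a b = d a b.
Proof. by rewrite /truncate => -> ->. Qed.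

(** Replaying the run on the distances known at time [k] reproduces all earlier states, since nested
    truncations collapse. *)
Lemma run_truncate d j k : (j <= k)%N -> run (truncate k.*2 d) j = run d j.
Proof.
elim: j => [//|j IH] jk; rewrite /= IH 1?ltnW//; congr next.
apply/funext => a; apply/funext => b; rewrite /truncate.
case: ifP => // /andP[aj bj].
have jk2 : (j.+1.*2 <= k.*2)%N by rewrite leq_double.
by rewrite (leq_trans aj jk2) (leq_trans bj jk2).
Qed.

Lemma run_good d k : (forall n, semimetric_on d n) -> good d k (run d k).
Proof.
move=> S; elim: k => [|k IH].
  by split; [split|exact: hierarchy0|move=> *; rewrite /potential big_nil].
have E a b : (a < k.+1.*2)%N -> (b < k.+1.*2)%N ->
  truncate k.+1.*2 d a b = d a b by exact: truncate_lt.
apply: (good_congr E); rewrite /= /next; case: pselect => [h|[]].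
  by case: cid => st' [].
apply: advance_exists; first by apply: semimetric_congr (S _) => *; rewrite E.
by apply: good_congr IH => a b ak bk; rewrite E// doubleS ltnW// ltnW.
Qed.

Lemma run_recourse d k : (forall n, semimetric_on d n) ->
  (recourse (edges_of (st_pairs (run d k)))
            (edges_of (st_pairs (run d k.+1))) <= (budget k.+1).*2)%N.
Proof.
move=> S; rewrite [run d k.+1]/= /next; case: pselect => [h|_].
  by case: cid => st' [].
by rewrite /recourse fsetDv cardfs0.
Qed.

Definition of_matrix n (A : 'M[R]_n) (a b : nat) : R :=
  if (insub a, insub b) is (Some i, Some j) then A i j else 0.

Lemma of_revealed (X : metricType R) (s : nat -> X) k :
  of_matrix (revealed s k) = truncate k.*2 (fun a b => mdist (s a) (s b)).
Proof.
apply/funext => a; apply/funext => b; rewrite /of_matrix /truncate.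
case: insubP => [i -> <-|/negbTE->//]; case: insubP => [j -> <-|/negbTE->//].
by rewrite mxE.
Qed.

(** The whole run is recomputed from the revealed matrix, as [online_algorithm] carries no state. *)
Definition algorithm : online_algorithm R :=
  fun k A => edges_of (st_pairs (run (of_matrix A) k)).

Lemma current_algorithm (X : metricType R) (s : nat -> X) k :
  current_matching algorithm s k =
  edges_of (st_pairs (run (fun a b => mdist (s a) (s b)) k)).
Proof.
case: k => [|k].
  by apply/fsetP => e; rewrite inE; apply/esym/edges_ofP => -[].
by rewrite /current_matching /algorithm of_revealed run_truncate.
Qed.

End Algorithm.

(** * Weight of the maintained matching *)

Section Cost.
Variable R : realType.
Variables (X : metricType R) (s : nat -> X).
Let d a b := mdist (s a) (s b).

Lemma mdist_semimetric n : semimetric_on d n.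
Proof.
split=> *; [exact: mdistxx | exact: metric_sym | exact: metric_triangle].
Qed.

(** Turns lengths into counts of long edges: halving the last scale is paid for by the new summand,
    unless [x] is already below the halved scale. *)
Lemma dyadic_sum (D x : R) r : 0 <= D -> x <= D ->
  x <= D / 2 ^+ r + \sum_(j < r) (D / 2 ^+ j.+1) *+ (D / 2 ^+ j.+1 <= x)%R.
Proof.
move=> D0 xD; elim: r => [|r IH]; first by rewrite big_ord0 addr0 expr0 divr1.
rewrite big_ord_recr /=.
have -> : D / 2 ^+ r.+1 = (D / 2 ^+ r) / 2 by rewrite exprSr invfM mulrA.
move: IH; set S := \sum_(_ < _) _; set y := D / _ => IH.
have S0 : 0 <= S.
  by apply: sumr_ge0 => j _; rewrite mulrn_wge0// divr_ge0// exprn_ge0.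
by have [yx|xy] := leP (y / 2) x; rewrite ?mulr1n ?mulr0n; lra.
Qed.

Lemma sum_inv_exp2 J : \sum_(j < J) (2 ^+ j)^-1 <= 2 :> R.
Proof.
have -> : \sum_(j < J) (2 ^+ j)^-1 = 2 - 2 * (2 ^+ J)^-1 :> R.
  elim: J => [|J IH]; first by rewrite big_ord0 expr0 invr1; lra.
  by rewrite big_ord_recr /= IH exprS invfM; lra.
by rewrite gerBl mulr_ge0// invr_ge0 exprn_ge0.
Qed.

(** By [centers_le], level [j] contributes [rho + 16 * W / 2 ^ j]; the geometric series yields
    32. *)
Lemma capacity_le n lam u (T : edge_set) rho J : hierarchy d n lam u ->
  (forall x y : 'I_n, connect (Defs.adjacent T) x y) -> 0 < rho ->
  (capacity lam n rho J)%:R * rho <= J%:R * rho + 32 * weight s T.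
Proof.
move=> H conn r0; set W := weight s T.
have W0 : 0 <= W by apply: sumr_ge0 => e _; exact: mdist_ge0.
have cj j : (centers lam n (2 ^+ j * rho / 2))%:R * rho <=
    rho + 16 * W * (2 ^+ j)^-1.
  have e0 : 0 < 2 ^+ j * rho / 2 by rewrite divr_gt0// mulr_gt0// exprn_gt0.
  apply: le_trans (ler_wpM2r (ltW r0)
    (centers_le (mdist_semimetric n) H conn e0)) _.
  rewrite -/W le_eqVlt; apply/orP; left; apply/eqP; field.
  by rewrite expf_neq0//= gt_eqF.
rewrite /capacity natr_sum mulr_suml.
apply: le_trans (ler_sum _ (fun (j : 'I_J) _ => cj j)) _.
rewrite big_split /= sumr_const card_ord [J%:R * rho]mulr_natl lerD2l.
rewrite -mulr_sumr.
by have := ler_wpM2l (mulr_ge0 (ler0n R 16) W0) (sum_inv_exp2 J); lra.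
Qed.

Lemma matching_weight k st (T : edge_set) : (0 < k)%N -> good d k st ->
  (forall x y : 'I_k.*2, connect (Defs.adjacent T) x y) ->
  weight s (edges_of (st_pairs st)) <=
  156 * (trunc_log 2 k.*2)%:R * weight s T.
Proof.
move=> k0 [MP H pot] conn; set M := st_pairs st; set r := trunc_log 2 _.
set W := weight s T; set u := st_u st; have [Mn _] := MP.
have n0 : (0 < k.*2)%N by rewrite double_gt0.
pose z : 'I_k.*2 := Ordinal n0.
have [[a b] _ dmax] := @arg_maxP _ R _ (z, z) xpredT
  (fun p : 'I_k.*2 * 'I_k.*2 => d p.1 p.2) isT.
set D := d (a, b).1 (a, b).2 in dmax.
have D0 : 0 <= D by exact: mdist_ge0.
have DW : D <= W by apply: (mdist_le_weight _ conn) => /=.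
have dD x y : (x < k.*2)%N -> (y < k.*2)%N -> d x y <= D.
  by move=> xn yn; exact: (dmax (Ordinal xn, Ordinal yn)).
have uD x y : (x < k.*2)%N -> (y < k.*2)%N -> u x y <= D.
  move=> xn yn; have [c [e [cn en uce]]] := hi_bound H xn yn.
  exact: le_trans uce (dD _ _ cn en).
have r0 : (0 < r)%N by rewrite /r trunc_log_gt0 /= -[2%N]/(1.*2) leq_double.
have kr : (k <= 2 ^ r)%N.
  have : (k.*2 < 2 ^ r.+1)%N by rewrite trunc_log_ltn.
  by rewrite expnS mul2n ltn_double => /ltnW.
have to_u : weight s (edges_of M) <= 4 * \sum_(e <- M) u e.1 e.2.
  rewrite /weight (le_trans (sum_edges_of_le _ _))//.
    by move=> e; exact: mdist_ge0.
  rewrite mulr_sumr big_seq [leRHS]big_seq; apply: ler_sum => e /Mn[e1 e2].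
  rewrite (le_trans _ (hi_dominates (mdist_semimetric _) H e1 e2))//.
  rewrite /orient /minn /maxn /=; case: ltnP => _ //=.
  by rewrite /d (metric_sym (s e.1)).
(* With [J = j.+2] and [2 ^ J * rho = 2 * D], the capacity costs [J * rho + 32 * W], where
   [J * rho <= 2 * D], and the slack [4 * D]; [D <= W] makes this 38. *)
have heavy j : D / 2 ^+ j.+1 * (count (fun e : nat * nat =>
    D / 2 ^+ j.+1 <= u e.1 e.2)%R M)%:R <= 38 * W.
  set rho := D / _; have [->|Dn0] := eqVneq rho 0.
    by rewrite mul0r mulr_ge0// (le_trans D0).
  have e0 : 0 < 2 ^+ j.+1 :> R by rewrite exprn_gt0.
  have rho0 : 0 < rho by rewrite lt_def Dn0 divr_ge0// ltW.
  have rhoD : 2 ^+ j.+1 * rho = D by rewrite mulrC divfK// gt_eqF.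
  (* Since [2 ^ j.+1 * rho = D], the strict bound in [scales] takes one more doubling. *)
  have sc : scales d k.*2 rho j.+2.
    split=> // x y xn yn; rewrite exprS -mulrA rhoD.
    have := dD _ _ xn yn; have : 0 < D by rewrite -rhoD mulr_gt0.
    lra.
  have cP : (count (fun e : nat * nat => rho <= u e.1 e.2)%R M <=
      potential u rho j.+2 M)%N.
    by rewrite potential_exchange big_ord_recl /= expr0 mul1r leq_addr.
  have := capacity_le j.+2 H conn rho0; rewrite -/W.
  have := leq_trans cP (pot rho j.+2 sc).
  rewrite -(ler_nat R) natrD natrM natrX.
  move=> /(ler_wpM2l (ltW rho0)).
  have JJ : j.+2%:R * rho <= 2 ^+ j.+2 * rho.
    by rewrite ler_pM2r// -natrX ler_nat ltnW// ltn_expl.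
  have : 2 ^+ j.+2 * rho = 2 * D by rewrite exprS -mulrA rhoD.
  by move: JJ; set e := 2 ^+ j.+2; lra.
(* The [k <= 2 ^ r] remainders [D / 2 ^ r] sum to at most [W], and each of the [r] scales adds
   [38 * W]; hence 39, and 156 after the factor 4 of [to_u]. *)
have sumu : \sum_(e <- M) u e.1 e.2 <= 39 * r%:R * W.
  apply: (@le_trans _ _ (\sum_(e <- M) (D / 2 ^+ r +
      \sum_(j < r) (D / 2 ^+ j.+1) *+ (D / 2 ^+ j.+1 <= u e.1 e.2)%R))).
    rewrite big_seq [leRHS]big_seq; apply: ler_sum => e /Mn[e1 e2].
    by apply: dyadic_sum => //; exact: uD.
  rewrite big_split /= exchange_big /=.
  have szM : size M = k by apply: double_inj; exact: size_pairing MP.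
  have t1 : \sum_(e <- M) D / 2 ^+ r <= r%:R * W.
    rewrite big_const_seq count_predT szM iter_addr_0 -[_ *+ k]mulr_natr -mulrA.
    apply: (@le_trans _ _ D); last first.
      by rewrite (le_trans DW)// ler_peMl ?ler1n// (le_trans D0).
    rewrite ler_piMr// mulrC ler_pdivrMr ?exprn_gt0// mul1r.
    by rewrite -natrX ler_nat.
  have t2 : \sum_(j < r) \sum_(e <- M) (D / 2 ^+ j.+1) *+
      (D / 2 ^+ j.+1 <= u e.1 e.2)%R <= r%:R * (38 * W).
    apply: (@le_trans _ _ (\sum_(j < r) 38 * W)); last first.
      by rewrite sumr_const card_ord [leRHS]mulr_natl.
    apply: ler_sum => j _.
    rewrite sumrMnr -[_ *+ _]mulr_natr (_ : (\sum_(e <- M) _)%N =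
      count (fun e : nat * nat => D / 2 ^+ j.+1 <= u e.1 e.2)%R M) //.
    by rewrite -sum1_count [RHS]big_mkcond; apply: eq_bigr => e _; case: ifP.
  by move: t1 t2; lra.
by rewrite (le_trans to_u)//; move: sumu; lra.
Qed.

End Cost.

(** * From binary to natural logarithms, and the final bounds *)

Lemma trunc_log_ln (R : realType) n : (0 < n)%N ->
  (trunc_log 2 n)%:R * ln 2 <= ln n%:R :> R.
Proof.
move=> n0; rewrite mulrC mulr_natr -lnXn// ler_ln ?posrE ?exprn_gt0 ?ltr0n//.
by rewrite -natrX ler_nat trunc_logP.
Qed.

Theorem theorem1p8 (R : realType) :
  exists (C1 C2 : R) (A : online_algorithm R),
    forall (X : metricType R) (adv : adversary X) (s : nat -> X),
      generated_by A adv s ->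
      forall i : nat, (0 < i)%N ->
        let M := current_matching A s in
        [/\ perfect_matching i.*2 (M i),
            forall T : edge_set, minimum_spanning_tree s i.*2 T ->
              weight s (M i) <= C1 * ln (i.*2)%:R * weight s T
          & (recourse (M i.-1) (M i))%:R <= C2 * (ln (i.*2)%:R) ^+ 2].
Proof.
have l0 : 0 < ln 2 :> R by rewrite ln_gt0// ltr1n.
(* The 4 is two deleted edges per exchange times the factor 2 in [budget]; the powers of [ln 2]
   change the base of the logarithm. *)
exists (156 / ln 2), (4 / ln 2 ^+ 2), (@algorithm R) => X adv s _ i i0 M.
have S := mdist_semimetric s.
have G := run_good i S; have [MP _ _] := G.
set r := trunc_log 2 i.*2.
have rl : r%:R <= ln (i.*2)%:R / ln 2 :> R.
  by rewrite ler_pdivlMr// trunc_log_ln// double_gt0.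
have r1 : 1 <= r%:R :> R.
  by rewrite ler1n trunc_log_gt0 /= -[2%N]/(1.*2) leq_double.
rewrite /M !current_algorithm; split; first exact: perfect_edges_of.
  move=> T [[_ conn _] _]; rewrite (le_trans (matching_weight i0 G conn))//.
  rewrite ler_wpM2r//; first by apply: sumr_ge0 => e _; exact: mdist_ge0.
  by rewrite -mulrA ler_pM2l// mulrC.
have := run_recourse i.-1 S; rewrite prednK// -(ler_nat R) => /le_trans; apply.
set L := ln (i.*2)%:R in rl *.
rewrite /budget -/r -!muln2 !natrM.
have -> : 4 / ln 2 ^+ 2 * L ^+ 2 = 4 * (L / ln 2 * (L / ln 2)).
  by field; rewrite gt_eqF.
(* The recourse [4 * r] is linear in the logarithm; [1 <= r] turns it into the squared bound. *)
have : r%:R * 1 <= L / ln 2 * (L / ln 2).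
  by apply: ler_pM => //; exact: le_trans rl.
lra.
Qed.
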